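(* Let $n\ge1$ and let $\sigma,\tau\in\mathfrak{S}_n$ be two permutations satisfying $$\mathrm{Majcode}\,\sigma=\delta(\mathrm{Majcode}\,\tau).$$ Then $$\mathrm{Ligne}\,\sigma=\{1,2,\ldots,n-1\}\setminus \mathrm{Ligne}\,\tau .$$
   Context: Permutations $\sigma\in\mathfrak{S}_n$ are written as words $\sigma=x_1x_2\cdots x_n$ with $x_i=\sigma(i)$. For a word $w=y_1\cdots y_m$ with integer letters, $\mathrm{maj}\,w=\sum\{i\mid 1\le i\le m-1,\ y_i>y_{i+1}\}$. The ligne of route of $\sigma$ is $\mathrm{Ligne}\,\sigma=\{i\mid 1\le i\le n-1,\ x_i>x_{i+1}\}$. A word $d_1d_2\cdots d_n$ of integers is subexcedent if $0\le d_i\le i-1$ for all $i=1,\dots,n$; the set of these is $\mathrm{SE}_n$. The major index code $\mathrm{Majcode}:\mathfrak{S}_n\to \mathrm{SE}_n$ is the bijection sending $\sigma$ to $d_1\cdots d_n$ with $d_i=\mathrm{maj}(\sigma|_i)-\mathrm{maj}(\sigma|_{i-1})$, where $\sigma|_i\in\mathfrak{S}_i$ is obtained from the word $\sigma$ by erasing the letters $i+1,i+2,\dots,n$ (and $\sigma|_0$ is the empty word, with $\mathrm{maj}=0$). The complement map $\delta:\mathrm{SE}_n\to\mathrm{SE}_n$ is $\delta(d_1d_2\cdots d_n)=(0-d_1)(1-d_2)(2-d_3)\cdots(n-1-d_n)$. *)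

(* Defs.v *)
From HB Require Import structures.
From mathcomp Require Import all_boot all_order all_fingroup all_algebra.
From mathcomp Require Import zify.

Set Implicit Arguments.
Unset Strict Implicit.
Unset Printing Implicit Defensive.

(* [descent w i] is y_i > y_{i+1} for w = y_1 ... y_m and 1 <= i <= m - 1;
   positions in words are 1-based, whereas [nth] is 0-based. *)
Definition descent (w : seq nat) (i : nat) : bool :=
  nth 0 w i.-1 > nth 0 w i.

Definition maj (w : seq nat) : nat := \sum_(1 <= i < size w | descent w i) i.

(* The word x_1 ... x_n of a permutation, with letters in {1, ..., n}
   although 'S_n acts on {0, ..., n - 1}. *)
Definition word n (s : 'S_n) : seq nat := [seq (s i).+1 | i <- enum 'I_n].

Definition erase n (s : 'S_n) (i : nat) : seq nat :=
  [seq x <- word s | x <= i].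

(* The indices 1, ..., n - 1 are the nonzero elements of 'I_n. *)
Definition Ligne n (s : 'S_n) : {set 'I_n} :=
  [set i : 'I_n | (1 <= i) && descent (word s) i].

(* The entry d_{i+1} sits at the index i : 'I_n, whence the bound i. *)
Definition subexcedent n (d : n.-tuple int) : bool :=
  [forall i : 'I_n, (0 <= tnth d i)%R && (tnth d i <= i%:Z)%R].

Definition SE n := {d : n.-tuple int | subexcedent d}.

Definition delta_word n (d : n.-tuple int) : n.-tuple int :=
  [tuple (i%:Z - tnth d i)%R | i < n].

Lemma delta_subexcedent n (d : SE n) : subexcedent (delta_word (val d)).
Proof.
apply/forallP=> i; move/forallP: (valP d) => /(_ i).
rewrite tnth_mktuple; lia.
Qed.

Definition delta n (d : SE n) : SE n := Sub _ (delta_subexcedent d).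

(* The subtraction takes place in int, not in nat. *)
Definition Majcode_word n (s : 'S_n) : n.-tuple int :=
  [tuple ((maj (erase s i.+1))%:Z - (maj (erase s i))%:Z)%R | i < n].

(* The major index of w when its first letter sits at position k; it serves only
   to show that Majcode_word takes its values in SE n. *)
Fixpoint maj_from (k : nat) (w : seq nat) : nat :=
  if w is y :: w' then
    (if w' is z :: _ then (z < y) * k else 0) + maj_from k.+1 w'
  else 0.

Lemma maj_fromE k w :
  maj_from k w = \sum_(0 <= i < (size w).-1) descent w i.+1 * (k + i).
Proof.
elim: w k => [|y [|z w] IH] k; [by rewrite big_geq..|].
rewrite [LHS]/= -/(maj_from k.+1 (z :: w)) IH /= big_nat_recl // addn0.
by congr (_ + _); apply: eq_bigr => i _; rewrite addSnnS.
Qed.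

Lemma maj_from1 w : maj w = maj_from 1 w.
Proof.
rewrite maj_fromE /maj big_mkcond; case: w => [|y w]; first by rewrite !big_geq.
rewrite big_add1; apply: eq_bigr => i _.
by case: descent; rewrite /= ?mul1n ?mul0n.
Qed.

Lemma maj_from_shift k v :
  maj_from k v <= maj_from k.+1 v <= maj_from k v + (size v).-1.
Proof.
elim: v k => [|y [|z v] IH] k //; have := IH k.+1.
rewrite /= -/(maj_from _ (z :: v)); case: (z < y); lia.
Qed.

Lemma maj_from_insert k u x v : 0 < k -> all (fun y => y < x) (u ++ v) ->
  maj_from k (u ++ v) <= maj_from k (u ++ x :: v)
    <= maj_from k (u ++ v) + (k.-1 + size (u ++ v)).
Proof.
elim: u k => [|y u IH] k k0.
  case: v => [|z v] //= /andP[zx _].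
  have := maj_from_shift k (z :: v); rewrite /= zx; lia.
case: u IH => [_|y' u IH].
  case: v => [|z v] /=; first by move=> /andP[yx _]; rewrite ltnNge ltnW //=; lia.
  move=> /and3P[yx zx _]; rewrite zx (ltnNge x) (ltnW yx) /=.
  have := maj_from_shift k.+1 (z :: v); rewrite /=; case: (z < y); lia.
move=> /= /andP[_ H]; have := IH k.+1 isT H; rewrite /=; lia.
Qed.

Lemma word_uniq n (s : 'S_n) : uniq (word s).
Proof.
rewrite map_inj_uniq ?enum_uniq // => i j [] /val_inj; exact: perm_inj.
Qed.

Lemma erase_insert n (s : 'S_n) (i : 'I_n) :
  exists u v, [/\ erase s i = u ++ v, erase s i.+1 = u ++ i.+1 :: v,
                  all (fun y => y < i.+1) (u ++ v) & size (u ++ v) <= i].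
Proof.
have : i.+1 \in word s.
  by apply/mapP; exists ((s^-1)%g i); rewrite ?mem_enum ?permKV.
move=> iw; have := word_uniq s; rewrite /erase.
have w_gt0 : all (fun x => 0 < x) (word s) by apply/allP=> x /mapP[j _ ->].
case/splitPr: iw w_gt0 => a b w_gt0 wU.
have aux c : i.+1 \notin c -> [seq x <- c | x <= i.+1] = [seq x <- c | x <= i].
  move=> ic; apply: eq_in_filter => x xc.
  have : x != i.+1 by apply: contraNneq ic => <-.
  lia.
move: (wU); rewrite cat_uniq /= negb_or => /and4P[_ /andP[ia _] ib _].
rewrite !filter_cat /= leqnn ltnn !aux //.
exists [seq x <- a | x <= i], [seq x <- b | x <= i].
rewrite -filter_cat; split=> //; first exact: filter_all.
rewrite -[X in _ <= X](size_iota 1); apply: uniq_leq_size.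
  apply: filter_uniq; apply: subseq_uniq wU.
  by rewrite cat_subseq // subseq_cons.
move=> x; rewrite mem_filter mem_iota => /andP[xi xw].
rewrite add1n ltnS xi andbT; apply: (allP w_gt0).
by move: xw; rewrite !mem_cat inE => /orP[] ->; rewrite ?orbT.
Qed.

Lemma Majcode_subexcedent n (s : 'S_n) : subexcedent (Majcode_word s).
Proof.
apply/forallP=> i; rewrite tnth_mktuple.
have [u [v [-> -> H1 H2]]] := erase_insert s i.
have := maj_from_insert (k := 1) isT H1; rewrite !maj_from1; lia.
Qed.

Definition Majcode n (s : 'S_n) : SE n := Sub _ (Majcode_subexcedent s).

(* Main.v *)
Require Import Defs.
From HB Require Import structures.
From mathcomp Require Import all_boot all_order all_fingroup all_algebra.
From mathcomp Require Import zify.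

(** Record the descents of a word w as the boolean word b whose i-th bit tells
    whether i is a descent, so that maj w is the weight \sum_i i * b_i.  Erasing
    the maximal letter of a word deletes one bit of b.  By Levenshtein's
    argument for Varshamov-Tenengolts codes, a boolean word is determined by its
    weight and the word left after one deletion.  Complementing all the bits
    commutes with deletions and replaces the weight m of a word of n - 1 bits by
    n(n-1)/2 - m, which on major index codes is delta; so the descent words
    of the restrictions of s and t are complementary, by induction on the size
    of the restriction. *)

Definition descent_word (w : seq nat) : seq bool :=
  if w is y :: w' then pairmap (fun a b => b < a) y w' else [::].

Fixpoint weight (k : nat) (b : seq bool) : nat :=
  if b is c :: b' then c * k + weight k.+1 b' else 0.

Lemma weight_cat k b c : weight k (b ++ c) = weight k b + weight (k + size b) c.
Proof.
elim: b k => [|a b IH] k /=; first by rewrite addn0.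
by rewrite IH addnA addSnnS.
Qed.

Lemma weightS k b : weight k.+1 b = weight k b + count id b.
Proof. elim: b k => [|a b IH] k //=; rewrite IH; case: a => /=; lia. Qed.

Lemma weight_negb k b :
  weight k [seq ~~ c | c <- b] + weight k b = weight k (nseq (size b) true).
Proof. elim: b k => [|a b IH] k //=; rewrite -IH; case: a => /=; lia. Qed.

Lemma weight_nseqS k m :
  weight k (nseq m.+1 true) = weight k (nseq m true) + (k + m).
Proof. by rewrite -addn1 nseqD weight_cat size_nseq /= mul1n addn0. Qed.

Lemma cons_nseq_cat (T : Type) m (a : T) v :
  a :: nseq m a ++ v = nseq m a ++ a :: v.
Proof. by elim: m => //= m ->. Qed.

(** The two insertion points enclose a block [y]. Equal weights force [a = c] and make [y] constant
    with value [a], so inserting [a] before or after [y] gives the same word. *)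
Lemma weight_insert_inj k u1 v1 a u2 v2 c : 0 < k ->
  u1 ++ v1 = u2 ++ v2 ->
  weight k (u1 ++ a :: v1) = weight k (u2 ++ c :: v2) ->
  u1 ++ a :: v1 = u2 ++ c :: v2.
Proof.
move=> k0; wlog le12 : u1 v1 a u2 v2 c / size u1 <= size u2 => [hw|] eqb eqw.
  case/orP: (leq_total (size u1) (size u2)) => le; first exact: hw.
  by symmetry; apply: hw.
have def_u2 : u2 = u1 ++ drop (size u1) u2.
  rewrite -{1}(cat_take_drop (size u1) u2); congr (_ ++ _).
  by move/(congr1 (take (size u1))): eqb; rewrite take_size_cat // takel_cat.
move: (drop _ _) def_u2 => y def_u2; subst u2 => {le12}.
move/eqP: eqb; rewrite -catA eqseq_cat // eqxx => /eqP def_v1; subst v1.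
move: eqw; rewrite -!catA !weight_cat /= => /addnI.
rewrite !weight_cat /= weightS addSn => eqw; congr (_ ++ _).
(* Moving a bit 0 (resp. 1) from the front to the end of y changes the weight by
   the number of 1s (resp. 0s) in y. *)
have cnt := count_size id y.
(* With [K = k + size u1], [eqw] amounts to [a * K + count id y = c * (K + size y)], where [K > 0]
   and [count id y <= size y]. *)
have [def_a def_y] : a = c /\ count id y = if c then size y else 0.
  by case: a c eqw => [] [] /=; lia.
rewrite -{}def_a in def_y *.
suff -> : y = nseq (size y) a by rewrite cons_nseq_cat.
apply/all_pred1P; rewrite all_count; case: a def_y {eqw} => def_y.
  by rewrite -def_y; apply/eqP/eq_count => -[].
rewrite -(count_predC id y) def_y add0n; apply/eqP/eq_count => -[] //.
Qed.

Lemma descent_word_cat y u z v :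
  descent_word (rcons u y ++ z :: v) =
  descent_word (rcons u y) ++ (z < y) :: descent_word (z :: v).
Proof.
by case: u => [|x u] //=; rewrite pairmap_cat last_rcons.
Qed.

(** Between [y] and [z], the maximal letter turns the bit [z < y] into the bits 0, 1, one of which
    is the old bit. In front it adds a leading 1, at the end a final 0. *)
Lemma descent_word_insert x u v : u ++ v != [::] ->
  all (fun y => y < x) (u ++ v) ->
  exists b1 b2 c, descent_word (u ++ v) = b1 ++ b2 /\
                  descent_word (u ++ x :: v) = b1 ++ c :: b2.
Proof.
case/lastP: u => [|u y].
  case: v => [|z v] //= _ /andP[zx _].
  by exists [::], (descent_word (z :: v)), true; rewrite /= zx.
rewrite all_cat all_rcons => _ /andP[/andP[yx _] vx].
have xy : (x < y) = false by lia.
case: v vx => [|z v] /=.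
  exists (descent_word (rcons u y)), [::], false.
  by rewrite descent_word_cat xy !cats0.
move=> /andP[zx _]; rewrite !descent_word_cat /= xy zx.
case: (z < y); last first.
  exists (rcons (descent_word (rcons u y)) false), (descent_word (z :: v)), true.
  by rewrite !cat_rcons.
by exists (descent_word (rcons u y)), (true :: descent_word (z :: v)), false.
Qed.

Lemma weight_descent_word w : weight 1 (descent_word w) = maj w.
Proof.
rewrite maj_from1; elim: w 1%N => [|y [|z w] IH] k //=.
by rewrite -[pairmap _ _ _]/(descent_word (z :: w)) IH.
Qed.

Lemma size_descent_word w : size (descent_word w) = (size w).-1.
Proof. by case: w => //= y w; rewrite size_pairmap. Qed.

Lemma nth_descent_word w i : i.+1 < size w ->
  nth false (descent_word w) i = descent w i.+1.
Proof.
by case: w => //= y w i_lt; rewrite /descent /= (nth_pairmap 0).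
Qed.

Section Erase.

Context {n : nat} (s : 'S_n).

Lemma erase0 : erase s 0 = [::].
Proof.
by apply/eqP; rewrite -[_ == _]negbK -has_filter has_map has_pred0.
Qed.

Lemma erase_word : erase s n = word s.
Proof. by apply/all_filterP/allP => x /mapP[j _ ->]. Qed.

Lemma size_erase i : i <= n -> size (erase s i) = i.
Proof.
elim: i => [|i IH] ltin; first by rewrite erase0.
have [u [v [/= eq1 -> _ _]]] := erase_insert s (Ordinal ltin).
by rewrite size_cat /= addnS -size_cat -eq1 IH // ltnW.
Qed.

Lemma descent_word_eraseS i : 0 < i < n ->
  exists b1 b2 c, descent_word (erase s i) = b1 ++ b2 /\
                  descent_word (erase s i.+1) = b1 ++ c :: b2.
Proof.
case/andP=> i0 ltin.
have [u [v [/= eq1 -> lt _]]] := erase_insert s (Ordinal ltin).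
rewrite eq1; apply: descent_word_insert lt.
by rewrite -eq1 -size_eq0 size_erase ?(ltnW ltin) // -lt0n.
Qed.

End Erase.

(** The entries of the two codes at the 0-based index [i] add up to [i]; moving the subtracted terms
    across gives an identity in [nat]. *)
Lemma Majcode_deltaP n (s t : 'S_n) i : Majcode s = delta (Majcode t) -> i < n ->
  maj (erase s i.+1) + maj (erase t i.+1) = maj (erase s i) + maj (erase t i) + i.
Proof.
move=> hst ltin; have := congr1 (fun d => tnth (val d) (Ordinal ltin)) hst.
rewrite /= !tnth_mktuple /=; lia.
Qed.

Lemma descent_word_compl n (s t : 'S_n) i :
  Majcode s = delta (Majcode t) -> i <= n ->
  descent_word (erase s i) = [seq ~~ c | c <- descent_word (erase t i)].
Proof.
(* Size 1 is a separate base case: the first letter adds no bit. *)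
move=> hst; elim: i => [|[|i] IH] ltin; first by rewrite !erase0.
  have nil1 (r : 'S_n) : descent_word (erase r 1) = [::].
    by apply: size0nil; rewrite size_descent_word size_erase.
  by rewrite !nil1.
have /= {}IH := IH (ltnW ltin).
have [b1 [b2 [c [eqs eqs']]]] := @descent_word_eraseS n s i.+1 ltin.
have [b3 [b4 [d [eqt eqt']]]] := @descent_word_eraseS n t i.+1 ltin.
have maj_compl := @Majcode_deltaP n s t i.+1 hst ltin.
have weight_t := weight_negb 1 (descent_word (erase t i.+1)).
have weight_t' := weight_negb 1 (descent_word (erase t i.+2)).
move: weight_t weight_t'.
rewrite -IH !size_descent_word !size_erase ?(ltnW ltin) //.
rewrite weight_nseqS -pred_Sn !weight_descent_word => weight_t weight_t'.
(* The all-ones weight grows by [i.+1], exactly as the sum of the two major indices does in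
   [maj_compl]. *)
have eqw : weight 1 (descent_word (erase s i.+2)) =
           weight 1 [seq ~~ c | c <- descent_word (erase t i.+2)].
  by rewrite weight_descent_word; lia.
move: eqw; rewrite eqs' eqt' map_cat /=; apply: weight_insert_inj => //.
by rewrite -eqs IH eqt map_cat.
Qed.

Theorem theorem2 (n : nat) (hn : 1 <= n) (s t : 'S_n)
  (hst : Majcode s = delta (Majcode t)) :
  Ligne s = [set i : 'I_n | 1 <= i] :\: Ligne t.
Proof.
have := descent_word_compl _ _ _ _ hst (leqnn n); rewrite !erase_word => compl.
have size_word (r : 'S_n) : size (word r) = n by rewrite size_map size_enum_ord.
(* Index 0 lies in neither set; index [i.+1] is read off bit [i]. *)
apply/setP => -[[|i] ltin]; rewrite !inE //= andbT.
rewrite -!nth_descent_word ?size_word // compl (nth_map false) //.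
by rewrite size_descent_word size_word; lia.
Qed.
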